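(* Let $T>0$ and let $\Omega_0\subset\mathbb{R}^n$ be an open set such that $\partial\Omega_0$ has a unique smooth evolution by mean curvature flow in $(0,T]$; for $t\in(0,T]$ let $\Omega_t\subset\mathbb{R}^n$ be the open set such that $\partial\Omega_t$ agrees with the evolution of $\partial\Omega_0$ at time $t$, and let $\mathcal{D}=\bigcup_{t\in[0,T]}\Omega_t\times\{t\}$. Let $u_0:\Omega_0\to\mathbb{R}$ be a locally Lipschitz function defining a proper graph $M_0=\{(x,u_0(x)):x\in\Omega_0\}\subset\mathbb{R}^{n+1}$. Let $u_1,u_2:\mathcal{D}\setminus(\Omega_0\times\{0\})\to\mathbb{R}$ be two smooth solutions of $$u_t=\sum_{i,j=1}^n\Big(\delta^{ij}-\frac{D_iu\,D_ju}{1+|Du|^2}\Big)D_{ij}u\qquad\text{on }\mathcal{D}\setminus(\Omega_0\times\{0\}),$$ such that, for $i=1,2$ and each $t\in(0,T]$, the graph $M^i_t=\{(x,u_i(x,t)):x\in\Omega_t\}$ is a proper graph over $\Omega_t$, with the same initial data $u_0$, that is, $\lim_{t\to0}u_1(\cdot,t)=\lim_{t\to0}u_2(\cdot,t)=u_0$. Assume that there is a constant $c>0$ such that both $u=u_1$ and $u=u_2$ satisfy $$v\,h^i_j\ge -c\,\delta^i_j\qquad\text{at all points of the graph of }u(\cdot,t),\ \text{for all }t\in(0,T].$$ Assume in addition that, for $i=1,2$, if $(x_k,t_k)$ is a sequence in $\mathcal{D}$ with $(x_k,t_k)\to(\bar x,\bar t)\in\partial\mathcal{D}$ and $|\bar x|\le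 R$ for some $R>0$, then $u_i(x_k,t_k)\to\infty$. Then $u_1=u_2$ on $\mathcal{D}$, that is, $M^1_t=M^2_t$ for all $t\in(0,T]$.
   Context: A graph $\{(x,u(x)):x\in\Omega\}$ over an open set $\Omega\subset\mathbb{R}^n$ is called proper if $u(x)\to+\infty$ as $x\to\partial\Omega$ or $|x|\to+\infty$ (the latter being required if $\Omega$ is unbounded). The set $\mathcal{D}$ is relatively open in $\mathbb{R}^n\times[0,T]$ and $\partial\mathcal{D}$ denotes its relative boundary in $\mathbb{R}^n\times[0,T]$; $u_i(\cdot,0)$ is understood as $u_0$. The limits $\lim_{t\to0}u_i(\cdot,t)=u_0$ are understood as uniform convergence on compact subsets of $\Omega_0$. For a smooth function $u(\cdot,t)$: $v=\sqrt{1+|Du|^2}$ is the gradient function of its graph, and $$h^i_j=\sum_l\Big(\delta^{il}-\frac{D_iu\,D_lu}{1+|Du|^2}\Big)\frac{D_{lj}u}{\sqrt{1+|Du|^2}}$$ is the second fundamental form (as a mixed tensor) of the graph. The inequality $v\,h^i_j\ge -c\,\delta^i_j$ is an inequality of endomorphisms that are self-adjoint with respect to the induced metric $g_{ij}=\delta_{ij}+D_iu\,D_ju$; equivalently, all principal curvatures $\lambda$ of the graph satisfy $v\lambda\ge -c$, i.e. $D_{ij}u\,\xi^i\xi^j\ge -c\,(|\xi|^2+\langle Du,\xi\rangle^2)$ for all $\xi\in\mathbb{R}^n$. *)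

(* Defs.v *)
(* MathComp-Analysis.  Space-time points (x, t) of R^n x R are pairs in
   'rV[R]_n * R.  A function on a subset of R^n or of R^n x R is a total
   function; only its values on that subset are ever constrained. *)
From HB Require Import structures.
From mathcomp Require Import all_boot all_order all_algebra.
From mathcomp Require Import all_classical all_reals all_analysis.

Set Implicit Arguments.
Unset Strict Implicit.
Unset Printing Implicit Defensive.

Import Order.TTheory GRing.Theory Num.Theory.
Import numFieldNormedType.Exports.

Local Open Scope classical_set_scope.
Local Open Scope ring_scope.

Section Topology.
Variable V : topologicalType.
Implicit Types S A : set V.

Definition boundary A : set V := closure A `\` A°.

Definition relatively_open S A : Prop := exists2 O, open O & A = S `&` O.

Definition relative_boundary S A : set V :=
  S `&` (closure A `&` closure (S `\` A)).

End Topology.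

Section Smooth.
Variables (R : realType) (V : normedModType R).
Implicit Types (A U : set V) (f : V -> R).

(* C^k on U.  Meaningful for U open, where it is the usual notion (V being
   finite dimensional): 'D_v f then only depends on f near the point. *)
Fixpoint Ck (k : nat) U f : Prop :=
  (forall x, U x -> {for x, continuous f}) /\
  if k is k'.+1 then
    forall v, (forall x, U x -> derivable f x v) /\ Ck k' U ('D_v f)
  else True.

(* Local smooth extensions: this is how smoothness up to the final time T is
   expressed, since R^n x (0, T] is not open in R^n x R. *)
Definition smooth_on A f : Prop :=
  forall p, A p -> exists U g,
    [/\ open U, U p, (forall k, Ck k U g) & {in U `&` A, g =1 f}].

End Smooth.

Section Graphs.
Variables (R : realType) (n : nat).
Implicit Types (W K : set 'rV[R]_n) (f : 'rV[R]_n -> R) (x : 'rV[R]_n).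

(* The library norm of 'rV[R]_n is the sup norm; this is the Euclidean one. *)
Definition sqnorm (p : 'rV[R]_n) : R := \sum_i p 0 i ^+ 2.
Definition enorm (p : 'rV[R]_n) : R := Num.sqrt (sqnorm p).

Definition partial (i : 'I_n) f x : R := 'D_(delta_mx 0 i) f x.
Definition gradient f x : 'rV[R]_n := \row_i partial i f x.
Definition hessian f x : 'M[R]_n := \matrix_(i, j) partial i (partial j f) x.

Definition gradient_function f x : R := Num.sqrt (1 + sqnorm (gradient f x)).

Definition metric f x : 'M[R]_n :=
  \matrix_(i, j) ((i == j)%:R + partial i f x * partial j f x).

Definition inverse_metric f x : 'M[R]_n :=
  \matrix_(i, j) ((i == j)%:R -
    partial i f x * partial j f x / (1 + sqnorm (gradient f x))).

(* h^i_j, the upper index i being the row index: the matrix of the Weingarten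
   endomorphism acting on column vectors. *)
Definition second_fundamental_form f x : 'M[R]_n :=
  \matrix_(i, j) \sum_l
    inverse_metric f x i l * (hessian f x l j / gradient_function f x).

(* A >= B for endomorphisms self-adjoint with respect to the metric g *)
Definition endo_ge (g A B : 'M[R]_n) : Prop :=
  forall xi : 'cV[R]_n,
    (xi^T *m g *m (B *m xi)) 0 0 <= (xi^T *m g *m (A *m xi)) 0 0.

Definition graph W f : set ('rV[R]_n * R) := [set (x, f x) | x in W].

(* The second condition is vacuous when W is bounded. *)
Definition proper_graph W f : Prop :=
  (forall x0, boundary W x0 -> f x @[x --> within W (nbhs x0)] --> +oo) /\
  (forall K : R, exists r : R, forall x, W x -> r < enorm x -> K < f x).

Definition locally_lipschitz W f : Prop :=
  forall x, W x -> exists2 U, nbhs x U & [lipschitz f y | y in W `&` U].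

End Graphs.

Section HypersurfaceFlow.
Variables (R : realType) (n : nat).
Implicit Types (M : R -> set 'rV[R]_n).
Implicit Types (F : 'rV[R]_n * R -> R) (f : 'rV[R]_n -> R) (T : R).

(* For a level set {f = const} with unit normal Df / |Df|: the mean curvature,
   i.e. the trace of the second fundamental form, positive for a sphere with
   outward normal. *)
Definition unit_normal f (x : 'rV[R]_n) : 'rV[R]_n :=
  (enorm (gradient f x))^-1 *: gradient f x.
Definition mean_curvature f (x : 'rV[R]_n) : R :=
  \sum_i partial i (fun y => unit_normal f y 0 i) x.

(* Speed of the moving level set {F(., t) = 0} in direction DF / |DF|: a point
   x(t) on it satisfies F_t + DF . x'(t) = 0. *)
Definition normal_velocity F (p : 'rV[R]_n * R) : R :=
  - 'D_(0, 1) F p / enorm (gradient (fun y => F (y, p.2)) p.1).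

(* The family (M_t), t in (0, T], is a smooth family of closed embedded
   hypersurfaces moving by mean curvature: near each point of R^n x (0, T]
   its space-time track is either empty or the zero set of a smooth F with
   nonvanishing spatial gradient, and the velocity is minus the mean curvature
   times the unit normal. *)
Definition smooth_mcf T M : Prop :=
  forall p : 'rV[R]_n * R, 0 < p.2 <= T -> exists2 U, open_nbhs p U &
    (forall q, U q -> 0 < q.2 <= T -> ~ M q.2 q.1) \/
    exists F, [/\ forall k, Ck k U F,
      forall q, U q -> gradient (fun y => F (y, q.2)) q.1 != 0,
      forall q, U q -> 0 < q.2 <= T -> (M q.2 q.1 <-> F q = 0) &
      forall q, U q -> 0 < q.2 <= T -> M q.2 q.1 ->
        normal_velocity F q = - mean_curvature (fun y => F (y, q.2)) q.1].

(* M_t -> M0 as t -> 0+, locally in the Hausdorff sense (Kuratowski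
   convergence): M0 need not be smooth. *)
Definition starts_from M (M0 : set 'rV[R]_n) : Prop :=
  (forall x, M0 x -> forall U, nbhs x U ->
     \forall t \near 0^'+, M t `&` U !=set0) /\
  (forall x, ~ M0 x -> exists2 U, nbhs x U &
     \forall t \near 0^'+, M t `&` U = set0).

Definition smooth_evolution T (M0 : set 'rV[R]_n) M : Prop :=
  smooth_mcf T M /\ starts_from M M0.

Definition unique_smooth_evolution T (M0 : set 'rV[R]_n) M : Prop :=
  smooth_evolution T M0 M /\
  forall M', smooth_evolution T M0 M' -> forall t, 0 < t <= T -> M' t = M t.

End HypersurfaceFlow.

Section GraphicalFlow.
Variables (R : realType) (n : nat).
Implicit Types (T c : R) (Omega : R -> set 'rV[R]_n).
Implicit Types (u : 'rV[R]_n * R -> R).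

Definition slice u (t : R) : 'rV[R]_n -> R := fun x => u (x, t).

Definition slab T : set ('rV[R]_n * R) := [set p | 0 <= p.2 <= T].

Definition domain T Omega : set ('rV[R]_n * R) :=
  [set p | 0 <= p.2 <= T /\ Omega p.2 p.1].

(* the domain without its initial slice *)
Definition positive_domain T Omega : set ('rV[R]_n * R) :=
  domain T Omega `\` (Omega 0 `*` [set 0]).

(* u_t(x, t) = l, the derivative being one-sided at t = T *)
Definition time_derivative_is T u (p : 'rV[R]_n * R) (l : R) : Prop :=
  (u (p.1, s) - u p) / (s - p.2) @[s --> within `]0, T] (p.2)^'] --> l.

Definition graphical_mcf T Omega u : Prop :=
  forall p, positive_domain T Omega p ->
    time_derivative_is T u p
      (\sum_i \sum_j
         inverse_metric (slice u p.2) p.1 i j * hessian (slice u p.2) p.1 i j).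

(* u(., 0) is by convention u0, and u(., t) -> u0 as t -> 0+ uniformly on
   compact subsets of Omega_0. *)
Definition initial_data Omega (u0 : 'rV[R]_n -> R) u : Prop :=
  (forall x, Omega 0 x -> u (x, 0) = u0 x) /\
  (forall K, compact K -> K `<=` Omega 0 ->
     {uniform K, slice u t @[t --> 0^'+] --> u0}).

Definition smooth_proper_solution T Omega (u0 : 'rV[R]_n -> R) u : Prop :=
  [/\ smooth_on (positive_domain T Omega) u,
      graphical_mcf T Omega u,
      forall t, 0 < t <= T -> proper_graph (Omega t) (slice u t) &
      initial_data Omega u0 u].

(* v h^i_j >= - c delta^i_j *)
Definition curvature_bound T Omega c u : Prop :=
  forall t x, 0 < t <= T -> Omega t x ->
    endo_ge (metric (slice u t) x)
      (gradient_function (slice u t) x *: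
         second_fundamental_form (slice u t) x)
      (- c)%:M.

Definition blows_up_at_boundary T Omega u : Prop :=
  forall (q : nat -> 'rV[R]_n * R) (xbar : 'rV[R]_n) (tbar r : R),
    (forall k, domain T Omega (q k)) ->
    relative_boundary (slab T) (domain T Omega) (xbar, tbar) ->
    0 < r -> enorm xbar <= r ->
    q k @[k --> \oo] --> (xbar, tbar) ->
    u (q k) @[k --> \oo] --> +oo.

End GraphicalFlow.

Arguments slab {R} n T.

(* Main.v *)
Require Import Defs.
From HB Require Import structures.
From mathcomp Require Import all_boot all_order all_algebra.
From mathcomp Require Import all_classical all_reals all_analysis.
From mathcomp Require Import ring lra.

Import Order.TTheory GRing.Theory Num.Theory.
Import numFieldNormedType.Exports.

(** The function [exp (- u)] turns the infinite boundary values of a solution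
    into zero boundary values, and the comparison of [u1] with [u2] is a maximum
    principle for the gap [exp (- u2) - exp (- u1)].

    Suppose that this gap is positive somewhere. It vanishes at time [0], and it
    is small near the boundary of the domain and near spatial infinity, so that
    its product with [exp (- C t)] has a positive maximum, at a positive time
    ([comparison]). Write [E_i] for [exp (- u_i)] at the maximum; then
    [E1 < E2], [E1 Du1 = E2 Du2] and
    [E1 (D^2 u1 - Du1 Du1) <= E2 (D^2 u2 - Du2 Du2)]. Take the trace of the last
    inequality against the inverse metric of the graph of [u1]. The gradients
    are parallel and [|Du2| <= |Du1|], so the inverse metrics of the two graphs
    differ only along the common gradient direction, and the one of [u2] is the
    larger. In that direction [D^2 u2] is bounded below by the curvature
    hypothesis, which yields
    [E1 dt u1 - E2 dt u2 <= (2 c + 1) (E2 - E1)] ([graph_trace_comparison]).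
    With [C = 2 c + 2] this contradicts maximality in time
    ([weighted_gap_no_positive_max]). Exchanging the roles of [u1] and [u2]
    gives equality.

    That the maximum is attained requires [u2] to be large near spatial infinity
    uniformly in time. The curvature hypothesis says [D^2 u >= - c g], whose
    trace is [dt u >= - c n]. Going backwards in time at a fixed point therefore
    keeps [u] bounded above, the point cannot leave the domain, where [u] would
    blow up, and one reaches time [0] with [u0 <= u + c n t]
    ([lower_barrier]); and [u0] is proper. *)

Local Open Scope classical_set_scope.
Local Open Scope ring_scope.

Set Implicit Arguments.
Unset Strict Implicit.

(** * Maxima of functions of one variable *)

Section OneVariable.
Variable R : realType.
Implicit Types (k dk : R -> R) (s d l : R).

Lemma derivative_at_left_max k s l :
  is_derive (s : R) 1 k l -> (\forall r \near s^'-, k r <= k s) -> 0 <= l.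
Proof.
move=> /is_derive1_caratheodory[q [kE qc <-]] kmax.
have /cvg_at_left_filter qs := qc.
apply: (cvgr_to_ge qs); near=> r.
have rs : r < s by near: r; exact: nbhs_left_lt.
have : k r - k s <= 0 by rewrite subr_le0; near: r.
by rewrite kE; nra.
Unshelve. all: by end_near. Qed.

(** A positive second derivative would make [dk] positive just after [0], where
    it vanishes, so that [k] would exceed [k 0] there. *)
Lemma second_derivative_at_max k dk l :
  (\forall s \near (0 : R), is_derive (s : R) 1 k (dk s)) -> is_derive (0 : R) 1 dk l ->
  (\forall s \near (0 : R), k s <= k 0) -> dk 0 = 0 /\ l <= 0.
Proof.
move=> kdk dkl kmax.
have [d /= d0 Hd] : exists2 d, 0 < d &
    forall s, `|s| < d -> is_derive (s : R) 1 k (dk s) /\ k s <= k 0.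
  have /nbhs_ballP[d /= d0 dP] : \forall s \near (0 : R),
      is_derive (s : R) 1 k (dk s) /\ k s <= k 0.
    by near=> s; split; near: s.
  by exists d => // s sd; apply: dP; rewrite -ball_normE /= sub0r normrN.
have dk0 : dk 0 = 0.
  have k0 : is_derive (0 : R) 1 k 0.
    apply: (@derive1_at_max _ k (- d) d).
    - by rewrite lerNl; lra.
    - move=> t; rewrite in_itv /= => /andP[t1 t2].
      by have [[]] := Hd t (ltac:(by rewrite ltr_norml t1 t2)).
    - by rewrite in_itv /= oppr_lt0 d0.
    - move=> t; rewrite in_itv /= => /andP[t1 t2].
      by have [] := Hd t (ltac:(by rewrite ltr_norml t1 t2)).
  have [] := Hd 0 (ltac:(by rewrite normr0)).
  by move=> /@derive_val <- _; rewrite derive_val.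
split=> //; rewrite leNgt; apply/negP => l0.
have /is_derive1_caratheodory[q [dkE qc q0]] := dkl.
have [e /= e0 qe] : exists2 e, 0 < e & forall s, `|s| < e -> 0 < q s.
  have /nbhs_ballP[e /= e0 eP] : \forall s \near (0 : R), 0 < q s.
    by apply: (cvgr_gt _ qc); rewrite q0.
  by exists e => // s se; apply: eP; rewrite -ball_normE /= sub0r normrN.
pose b := Num.min d e / 2.
have m0 : 0 < Num.min d e by rewrite lt_min d0 e0.
have b0 : 0 < b by rewrite divr_gt0.
have bm : b < Num.min d e by rewrite /b; lra.
have [bd be] : b < d /\ b < e by apply/andP; rewrite -lt_min.
have dkb s : `|s| <= b -> is_derive (s : R) 1 k (dk s).
  by move=> sb; have [] := Hd s (le_lt_trans sb bd).
have dk_in z : z \in `]0, b[%R -> is_derive z 1 k (dk z).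
  by rewrite in_itv /= => /andP[z0 zb]; apply: dkb; rewrite gtr0_norm // ltW.
have kc : {within `[0, b], continuous k}.
  apply: derivable_within_continuous => r.
  rewrite in_itv /= => /andP[r0 rb].
  by have [] := dkb r (ltac:(by rewrite ger0_norm)).
have [z + H] := MVT b0 dk_in kc.
rewrite in_itv /= => /andP[z0 zb].
have [_ kb] := Hd b (ltac:(by rewrite gtr0_norm)).
move: H; have := dkE z; rewrite dk0 !subr0 => -> H.
have : 0 < q z * z * b.
  by rewrite !mulr_gt0 // qe // gtr0_norm // (lt_trans zb).
by rewrite -H subr_gt0 ltNge kb.
Unshelve. all: by end_near. Qed.

End OneVariable.

(** * Directional derivatives of smooth functions *)

Section DirectionalDerivatives.
Variables (R : realType) (V : normedModType R).
Implicit Types (U : set V) (g : V -> R) (p v w : V).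

Lemma is_derive_line g p v s : derivable g (p + s *: v) v ->
  is_derive (s : R) 1 (fun r => g (p + r *: v)) ('D_v g (p + s *: v)).
Proof.
have E : (fun h => h^-1 *: (((fun r => g (p + r *: v)) \o shift s) (h *: 1)
    - g (p + s *: v))) =
    (fun h => h^-1 *: ((g \o shift (p + s *: v)) (h *: v) - g (p + s *: v))).
  apply/funext => h /=; congr (_ *: (g _ - _)).
  by rewrite [h *: 1]mulr1 scalerDl addrCA addrC -addrA.
move=> dg; apply: DeriveDef.
  by rewrite /derivable E.
by rewrite /derive E.
Qed.

Lemma derivative_scale_direction g p v (a : R) : derivable g p v ->
  'D_(a *: v) g p = a * 'D_v g p.
Proof.
move=> dg.
have E : (fun r => g (p + r *: (a *: v))) = (fun r => g (p + r *: v)) \o (fun r => r * a).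
  by apply/funext => r /=; rewrite scalerA.
have d1 : is_derive (0 : R) 1 (fun r => g (p + r *: v)) ('D_v g p).
  have := @is_derive_line g p v 0.
  by rewrite scale0r addr0; exact.
have d2 : is_derive (0 : R) 1 (fun r => g (p + r *: (a *: v))) ('D_v g p * a).
  rewrite E; apply: is_derive1_comp; first by rewrite mul0r.
  by apply: is_derive_eq; rewrite scaler0 add0r [LHS]mulr1.
have Eq : (fun h : R => h^-1 *: ((g \o shift p) (h *: (a *: v)) - g p)) =
    (fun h : R => h^-1 *: (((fun r : R => g (p + r *: (a *: v))) \o shift (0 : R))
      (h *: 1) - g (p + (0 : R) *: (a *: v)))).
  apply/funext => h /=; rewrite [h *: 1]mulr1 addr0 scale0r addr0.
  by congr (_ *: (g _ - _)); exact: addrC.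
have -> : 'D_(a *: v) g p = 'D_1 (fun r : R => g (p + r *: (a *: v))) 0.
  by rewrite /derive Eq.
by rewrite (@derive_val _ _ _ _ _ _ _ d2) mulrC.
Qed.

(** The mean value theorem in the direction [w] moves the increment of [g] from
    [p + h v] to [p + h v + h w] onto a nearby point, where continuity of
    ['D_w g] applies. Since [g] is derivable in every direction, a limit along
    positive [h] suffices. *)
Lemma derivative_add_direction U g p v w : open U -> U p -> Ck 1 U g ->
  'D_(v + w) g p = 'D_v g p + 'D_w g p.
Proof.
move=> Uo Up [gc gC].
have dg z q : U q -> derivable g q z by move=> Uq; have [+ _] := gC z; apply.
pose F z h : R := h^-1 *: ((g \o shift p) (h *: z) - g p).
have Fc z : F z h @[h --> 0^'+] --> 'D_z g p.
  exact: cvg_dnbhs_at_right (dg z _ Up).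
suff Fw : (F (v + w) h - F v h) @[h --> 0^'+] --> 'D_w g p.
  have Fvw := cvgB (Fc (v + w)) (Fc v).
  have := cvg_unique (@norm_hausdorff _ R) (Fvw _) Fw.
  by move=> <-; rewrite [RHS]addrC subrK.
apply/cvgrPdist_le => e e0.
have /nbhs_ballP[d /= d0 dP] : \forall q \near p,
    U q /\ `|'D_w g p - 'D_w g q| < e.
  have [_ [Dc _]] := gC w.
  have De : \forall q \near p, `|'D_w g p - 'D_w g q| < e.
    by move/cvgrPdist_lt : (Dc _ Up); apply.
  have Un : \forall q \near p, U q by apply: open_nbhs_nbhs.
  by near=> q; split; near: q.
pose m := `|v| + `|w| + 1.
have m0 : 0 < m by rewrite ltr_wpDl // addr_ge0.
have dm0 : 0 < d / m by rewrite divr_gt0.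
near=> h.
have h0 : 0 < h by near: h; exact: nbhs_right_gt.
have hd : h * m < d.
  by rewrite -ltr_pdivlMr //; near: h; exact: nbhs_right_lt.
have close z : 0 <= z <= h -> U (p + h *: v + z *: w) /\
    `|'D_w g p - 'D_w g (p + h *: v + z *: w)| < e.
  move=> /andP[z0 zh]; apply: dP.
  rewrite -ball_normE /= -addrA opprD addNKr normrN.
  apply: le_lt_trans hd; rewrite (le_trans (ler_normD _ _)) //.
  rewrite !normrZ (ger0_norm z0) (gtr0_norm h0) /m.
  by have := normr_ge0 w; nra.
have dline z : 0 <= z <= h -> is_derive z 1
    (fun s => g (p + h *: v + s *: w)) ('D_w g (p + h *: v + z *: w)).
  by move=> zh; apply: is_derive_line; apply: dg; have [] := close _ zh.
have dline_in z : z \in `]0, h[%R -> is_derive z 1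
    (fun s => g (p + h *: v + s *: w)) ('D_w g (p + h *: v + z *: w)).
  by rewrite in_itv /= => /andP[z0 zh]; apply: dline; rewrite !ltW.
have line_cont : {within `[0, h], continuous (fun s => g (p + h *: v + s *: w))}.
  by apply: derivable_within_continuous => r; rewrite in_itv /= => /dline[].
have [z] := MVT h0 dline_in line_cont.
rewrite in_itv /= => /andP[z0 zh].
rewrite scale0r subr0 addr0 => H.
have -> : F (v + w) h - F v h = 'D_w g (p + h *: v + z *: w).
  rewrite /F /= -scalerBr opprB addrA subrK (scalerDr h).
  rewrite [_ + _ + p]addrC addrA [h *: v + p]addrC H.
  by rewrite [_ *: _]mulrC mulfK // gt_eqF.
by have [] := close z (ltac:(by rewrite !ltW)) => _ /ltW.
Unshelve. all: by end_near. Qed.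

Lemma derivative_sum_direction (I : Type) (r : seq I) (a : I -> R) (e : I -> V) U g p :
  open U -> U p -> Ck 1 U g ->
  'D_(\sum_(i <- r) a i *: e i) g p = \sum_(i <- r) a i * 'D_(e i) g p.
Proof.
move=> Uo Up Cg; elim: r => [|i r IH]; first by rewrite !big_nil derive0.
rewrite !big_cons (derivative_add_direction _ _ Uo Up Cg) IH derivative_scale_direction //.
by have [_ /(_ (e i))[+ _]] := Cg; exact.
Qed.

Lemma second_derivative_sum_direction (n : nat) (a : 'I_n -> R) (e : 'I_n -> V)
    U g p : open U -> U p -> Ck 2 U g ->
  'D_(\sum_i a i *: e i) ('D_(\sum_i a i *: e i) g) p =
  \sum_i \sum_j a i * a j * 'D_(e i) ('D_(e j) g) p.
Proof.
move=> Uo Up Cg.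
have C1 : Ck 1 U g.
  have [gc gC] := Cg; split=> // v; have [dv [cv _]] := gC v.
  by split.
set xi := \sum_i a i *: e i.
have -> : 'D_xi ('D_xi g) p = 'D_xi (\sum_j a j *: 'D_(e j) g) p.
  apply: near_eq_derive; near=> q.
  have Uq : U q by near: q; apply: open_nbhs_nbhs.
  by rewrite (derivative_sum_direction _ _ _ Uo Uq C1) fct_sumE.
have dj j v : derivable ('D_(e j) g) p v.
  by have [_ /(_ (e j))[_ [_ /(_ v)[+ _]]]] := Cg; exact.
rewrite derive_sum; last by move=> j; apply: derivableZ.
rewrite exchange_big /=; apply: eq_bigr => j _.
rewrite deriveZ //; have [_ /(_ (e j))[_ Cj]] := Cg.
rewrite (derivative_sum_direction _ _ _ Uo Up Cj) [_ *: _]mulr_sumr.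
by apply: eq_bigr => i _; rewrite mulrA [a j * _]mulrC.
Unshelve. all: by end_near. Qed.

End DirectionalDerivatives.

(** * Quadratic forms and traces in the metric of a graph *)

Section QuadraticForms.
Variables (R : realType) (n : nat).
Implicit Types (p q xi : 'I_n -> R) (P H : 'I_n -> 'I_n -> R).

Definition norm2 p : R := \sum_i p i ^+ 2.
Definition quad H xi : R := \sum_i \sum_j xi i * xi j * H i j.

(** The trace of [H] against the inverse of the metric [g_ij = delta_ij + p_i p_j],
    that is, the graphical mean curvature operator with gradient [p]. *)
Definition graph_trace p H : R :=
  \sum_i \sum_j ((i == j)%:R - p i * p j / (1 + norm2 p)) * H i j.

Lemma norm2_ge0 p : 0 <= norm2 p.
Proof. by apply: sumr_ge0 => i _; exact: sqr_ge0. Qed.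

Lemma sum_delta (i : 'I_n) (F : 'I_n -> R) : \sum_j (i == j)%:R * F j = F i.
Proof.
rewrite (bigD1 i) //= eqxx mul1r big1 ?addr0 // => j /negPf.
by rewrite eq_sym => ->; rewrite mul0r.
Qed.

Lemma graph_traceE p H :
  graph_trace p H = \sum_i H i i - quad H p / (1 + norm2 p).
Proof.
rewrite /graph_trace /quad mulr_suml -sumrB; apply: eq_bigr => i _.
rewrite mulr_suml -[H i i](sum_delta i) -sumrB; apply: eq_bigr => j _.
by rewrite mulrBl; congr (_ - _); ring.
Qed.

Lemma quad_linear (a b : R) P H xi :
  quad (fun i j => a * P i j + b * H i j) xi = a * quad P xi + b * quad H xi.
Proof.
rewrite /quad !mulr_sumr -big_split; apply: eq_bigr => i _ /=.
rewrite !mulr_sumr -big_split; apply: eq_bigr => j _ /=; ring.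
Qed.

Lemma quad_rank1 p xi :
  quad (fun i j => p i * p j) xi = (\sum_i p i * xi i) ^+ 2.
Proof.
rewrite expr2 /quad mulr_suml; apply: eq_bigr => i _.
by rewrite mulr_sumr; apply: eq_bigr => j _; ring.
Qed.

Lemma quad_scale_vector (k : R) H xi :
  quad H (fun i => k * xi i) = k ^+ 2 * quad H xi.
Proof.
rewrite /quad mulr_sumr; apply: eq_bigr => i _.
by rewrite mulr_sumr; apply: eq_bigr => j _; ring.
Qed.

Lemma quad_two_entries (i j : 'I_n) (a b : R) P :
  quad P (fun k => a * (i == k)%:R + b * (j == k)%:R) =
  a ^+ 2 * P i i + a * b * (P i j + P j i) + b ^+ 2 * P j j.
Proof.
have S (F : 'I_n -> R) :
    \sum_k (a * (i == k)%:R + b * (j == k)%:R) * F k = a * F i + b * F j.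
  rewrite -(sum_delta i F) -(sum_delta j F) !mulr_sumr -big_split.
  by apply: eq_bigr => k _ /=; ring.
rewrite /quad; under eq_bigr => k _.
  under eq_bigr => l _ do rewrite -mulrA.
  rewrite -mulr_sumr S.
  over.
by rewrite S; ring.
Qed.

(** Half the sum over [i, j] of the values of [P] at the vectors
    [p_j e_i - p_i e_j] is [|p|^2 tr P - P(p, p)]. *)
Lemma quad_le_trace P p : (forall xi, 0 <= quad P xi) ->
  quad P p <= norm2 p * \sum_i P i i.
Proof.
move=> P0; rewrite -subr_ge0.
suff : 0 <= 2 * (norm2 p * \sum_i P i i - quad P p) by lra.
have -> : 2 * (norm2 p * \sum_i P i i - quad P p) = \sum_i \sum_j
    quad P (fun k => p j * (i == k)%:R + (- p i) * (j == k)%:R).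
  have E i j : quad P (fun k => p j * (i == k)%:R + (- p i) * (j == k)%:R) =
      (p j ^+ 2 * P i i + p i ^+ 2 * P j j) +
      (- (p i * p j * P i j) - (p j * p i * P j i)).
    by rewrite quad_two_entries; ring.
  under [RHS]eq_bigr => i _ do (under eq_bigr => j _ do rewrite E).
  have S1 : \sum_i \sum_j p j ^+ 2 * P i i = norm2 p * \sum_i P i i.
    by rewrite mulr_sumr; apply: eq_bigr => i _; rewrite -mulr_suml.
  have S2 : \sum_i \sum_j p i ^+ 2 * P j j = norm2 p * \sum_i P i i.
    by rewrite exchange_big S1.
  have S3 : \sum_i \sum_j p j * p i * P j i = quad P p.
    by rewrite exchange_big.
  under [RHS]eq_bigr => i _ do rewrite !big_split sumrN /= sumrN.
  by rewrite !big_split /= !sumrN S1 S2 S3 -/(quad P p); ring.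
by apply: sumr_ge0 => i _; apply: sumr_ge0 => j _; exact: P0.
Qed.

(** The trace is [tr P - P(p, p) / (1 + |p|^2)], so [quad_le_trace] says that
    tracing against the inverse metric preserves nonnegativity. *)
Lemma graph_trace_ge0 P p : (forall xi, 0 <= quad P xi) -> 0 <= graph_trace p P.
Proof.
move=> P0; rewrite graph_traceE; have := quad_le_trace p P0.
have T0 : 0 <= \sum_i P i i.
  apply: sumr_ge0 => i _; have := P0 (fun k => 1 * (i == k)%:R + 0 * (i == k)%:R).
  by rewrite quad_two_entries; lra.
have := norm2_ge0 p; set S := norm2 p; set t := \sum_i _ in T0 * => S0 QS.
have S1 : 0 < 1 + S by lra.
rewrite subr_ge0 ler_pdivrMr //; nra.
Qed.

Lemma graph_trace_linear (a b : R) P H p :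
  graph_trace p (fun i j => a * P i j + b * H i j) =
  a * graph_trace p P + b * graph_trace p H.
Proof.
by rewrite !graph_traceE quad_linear big_split /= -!mulr_sumr; ring.
Qed.

Lemma graph_trace_rank1 p q : graph_trace p (fun i j => q i * q j) =
  norm2 q - (\sum_i q i * p i) ^+ 2 / (1 + norm2 p).
Proof.
by rewrite graph_traceE quad_rank1.
Qed.

Lemma graph_trace_metric p :
  graph_trace p (fun i j => (i == j)%:R + p i * p j) = n%:R.
Proof.
have -> : (fun i j => (i == j)%:R + p i * p j) =
    (fun i j : 'I_n => 1 * (i == j)%:R + 1 * (p i * p j)).
  by apply/funext => i; apply/funext => j; rewrite !mul1r.
rewrite graph_trace_linear graph_trace_rank1 graph_traceE.
have -> : \sum_(i < n) (i == i)%:R = n%:R :> R.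
  under eq_bigr => i _ do rewrite eqxx.
  by rewrite sumr_const card_ord.
have -> : quad (fun i j : 'I_n => (i == j)%:R) p = norm2 p.
  apply: eq_bigr => i _; under eq_bigr => j _ do rewrite mulrC.
  by rewrite sum_delta -expr2.
have -> : \sum_i p i * p i = norm2 p by apply: eq_bigr => i _; rewrite -expr2.
have := norm2_ge0 p; set S := norm2 p => S0.
by field; lra.
Qed.

Lemma metric_mul_inverse p i j :
  \sum_k ((i == k)%:R + p i * p k) *
    ((k == j)%:R - p k * p j / (1 + norm2 p)) = (i == j)%:R.
Proof.
set S := norm2 p.
have E k : ((i == k)%:R + p i * p k) * ((k == j)%:R - p k * p j / (1 + S)) =
    (i == k)%:R * ((k == j)%:R - p k * p j / (1 + S)) +
    (p i * ((j == k)%:R * p k) - p i * p j / (1 + S) * p k ^+ 2).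
  rewrite (eq_sym j k); move: (_%:R) (_%:R) (p i) (p j) (p k) (_^-1).
  by move=> a b x y z w; ring.
under eq_bigr => k _ do rewrite E.
rewrite !big_split /= sumrN sum_delta -!mulr_sumr sum_delta -/(norm2 p) -/S.
have S1 : 1 + S != 0 by have := norm2_ge0 p; rewrite -/S; lra.
by move: (_%:R) (p i) (p j) => a x y; field.
Qed.

(** A lower bound [H >= - c g] bounds the graphical mean curvature operator from
    below, since the trace of the metric with respect to itself is [n]. *)
Lemma graph_trace_lower_bound (c : R) p H :
  (forall xi, - c * (norm2 xi + (\sum_i p i * xi i) ^+ 2) <= quad H xi) ->
  - c * n%:R <= graph_trace p H.
Proof.
move=> Hc.
pose P i j : R := 1 * H i j + c * ((i == j)%:R + p i * p j).
have P0 xi : 0 <= quad P xi.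
  have -> : quad P xi = quad H xi + c * (norm2 xi + (\sum_i p i * xi i) ^+ 2).
    rewrite quad_linear mul1r; congr (_ + c * _).
    have -> : (fun i j => (i == j)%:R + p i * p j) =
        (fun i j : 'I_n => 1 * (i == j)%:R + 1 * (p i * p j)).
      by apply/funext => i; apply/funext => j; rewrite !mul1r.
    rewrite quad_linear quad_rank1 !mul1r; congr (_ + _).
    apply: eq_bigr => i _; under eq_bigr => j _ do rewrite mulrC.
    by rewrite sum_delta -expr2.
  by have := Hc xi; lra.
by have := graph_trace_ge0 p P0; rewrite graph_trace_linear graph_trace_metric; lra.
Qed.

(** The situation at a maximum of [exp (- u2) - exp (- u1)]. With [k = E2 / E1]
    one has [p1 = k p2]. Tracing the Hessian inequality against the inverse
    metric of [p1] leaves two errors. The gradient terms contribute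
    [k (k - 1) S / (1 + k^2 S)] with [S = |p2|^2], which is at most [k - 1]. The
    discrepancy of the two inverse metrics acts on [H2] in the direction [p2],
    and contributes [- k (k^2 - 1) Q / ((1 + S) (1 + k^2 S))] with
    [Q = H2(p2, p2)]; since [Q >= - c S (1 + S)], this is at most
    [2 c (k - 1)]. *)
Lemma graph_trace_comparison (c E1 E2 : R) p1 p2 H1 H2 :
  0 < c -> 0 < E1 < E2 -> (forall i, E1 * p1 i = E2 * p2 i) ->
  (forall xi, E1 * (quad H1 xi - (\sum_i p1 i * xi i) ^+ 2) <=
              E2 * (quad H2 xi - (\sum_i p2 i * xi i) ^+ 2)) ->
  (forall xi, - c * (norm2 xi + (\sum_i p2 i * xi i) ^+ 2) <= quad H2 xi) ->
  E1 * graph_trace p1 H1 - E2 * graph_trace p2 H2 <= (2 * c + 1) * (E2 - E1).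
Proof.
move=> c0 /andP[E0 E12] pE HE Hc.
pose k := E2 / E1.
have E2k : E2 = k * E1 by rewrite /k divfK // gt_eqF.
have k1 : 1 < k by rewrite ltr_pdivlMr // mul1r.
have p1k : p1 = fun i => k * p2 i.
  apply/funext => i; have := pE i; rewrite E2k => h.
  by apply: (mulfI (lt0r_neq0 E0)); rewrite h; ring.
pose P i j : R := 1 * (E2 * H2 i j + (- E2) * (p2 i * p2 j)) +
  (-1) * (E1 * H1 i j + (- E1) * (p1 i * p1 j)).
have P0 xi : 0 <= quad P xi.
  by rewrite !quad_linear !quad_rank1; have := HE xi; lra.
have := graph_trace_ge0 p1 P0.
rewrite !graph_trace_linear !graph_trace_rank1.
move: (graph_trace p1 H1) => A.
rewrite !graph_traceE.
have -> : norm2 p1 = k ^+ 2 * norm2 p2.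
  rewrite p1k /norm2 mulr_sumr; apply: eq_bigr => i _; ring.
have -> : \sum_i p1 i * p1 i = k ^+ 2 * norm2 p2.
  rewrite p1k /norm2 mulr_sumr; apply: eq_bigr => i _; ring.
have -> : \sum_i p2 i * p1 i = k * norm2 p2.
  rewrite p1k /norm2 mulr_sumr; apply: eq_bigr => i _; ring.
rewrite p1k quad_scale_vector.
have := Hc p2; have -> : \sum_i p2 i * p2 i = norm2 p2.
  by apply: eq_bigr => i _; rewrite -expr2.
have := norm2_ge0 p2.
set S := norm2 p2; set Q := quad H2 p2; set t := \sum_i _ => S0 QS.
rewrite E2k => hA.
have D0 : 0 < 1 + k ^+ 2 * S by nra.
have S1 : 0 < 1 + S by lra.
(* The traced Hessian inequality, divided by [E1]. *)
have {hA} hA : A <= k * t - k * (k ^+ 2 * Q) / (1 + k ^+ 2 * S) +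
    (k ^+ 2 * S - k * S) / (1 + k ^+ 2 * S).
  rewrite -(ler_pM2l E0) -subr_ge0; apply: le_trans hA _.
  rewrite le_eqVlt; apply/orP; left; apply/eqP; field; lra.
have -> : (2 * c + 1) * (k * E1 - E1) = E1 * ((2 * c + 1) * (k - 1)) by ring.
have -> : E1 * A - k * E1 * (t - Q / (1 + S)) =
   E1 * (A - k * (t - Q / (1 + S))) by ring.
rewrite ler_pM2l //.
suff : (k ^+ 2 * S - k * S) / (1 + k ^+ 2 * S) + k * Q / (1 + S) -
    k * (k ^+ 2 * Q) / (1 + k ^+ 2 * S) <= (2 * c + 1) * (k - 1).
  have -> : k * (t - Q / (1 + S)) = k * t - k * Q / (1 + S) by ring.
  by lra.
have -> : (k ^+ 2 * S - k * S) / (1 + k ^+ 2 * S) + k * Q / (1 + S) -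
    k * (k ^+ 2 * Q) / (1 + k ^+ 2 * S) =
    (k * (k - 1) * S + k * (k ^+ 2 - 1) * (- Q / (1 + S))) / (1 + k ^+ 2 * S).
  by field; apply/andP; split; lra.
have QS' : - Q / (1 + S) <= c * S by rewrite ler_pdivrMr //; lra.
rewrite ler_pdivrMr //; set q := - Q / _ in QS' *.
have k0 : 0 <= k by lra.
have kk1 : 1 <= k by lra.
have kS : k * S <= k ^+ 2 * S by rewrite ler_wpM2r // expr2 ler_peMl.
have h1 : k * (k ^+ 2 - 1) * q <= k * (k ^+ 2 - 1) * (c * S).
  by rewrite ler_wpM2l // mulr_ge0 // subr_ge0 expr_ge1.
apply: le_trans (_ : k * (k - 1) * S + k * (k ^+ 2 - 1) * (c * S) <= _); first by lra.
have -> : k * (k - 1) * S + k * (k ^+ 2 - 1) * (c * S) =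
   (k - 1) * (k * S + c * (k * k * S + k * S)) by ring.
have -> : (2 * c + 1) * (k - 1) * (1 + k ^+ 2 * S) =
   (k - 1) * ((2 * c + 1) * (1 + k ^+ 2 * S)) by ring.
rewrite ler_wpM2l //; first by lra.
have : c * (k * k * S + k * S) <= c * (2 * (k ^+ 2 * S)).
  apply: ler_wpM2l; first exact: ltW.
  by rewrite -expr2; lra.
by lra.
Qed.

End QuadraticForms.

(** * The curvature bound as a bound on the Hessian *)

Section GraphGeometry.
Variables (R : realType) (n : nat).
Implicit Types (f : 'rV[R]_n -> R) (x : 'rV[R]_n) (xi : 'I_n -> R).

Definition first_jet f x : 'I_n -> R := fun i => partial i f x.
Definition second_jet f x : 'I_n -> 'I_n -> R := fun i j => hessian f x i j.

Lemma sqnorm_gradient f x : sqnorm (gradient f x) = norm2 (first_jet f x).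
Proof. by apply: eq_bigr => i _; rewrite mxE. Qed.

Lemma graph_traceE_inverse_metric f x :
  \sum_i \sum_j inverse_metric f x i j * hessian f x i j =
  graph_trace (first_jet f x) (second_jet f x).
Proof.
apply: eq_bigr => i _; apply: eq_bigr => j _.
by rewrite [X in X * _]mxE sqnorm_gradient.
Qed.

Lemma metric_mulmx_inverse f x : metric f x *m inverse_metric f x = 1%:M.
Proof.
apply/matrixP => i j; rewrite !mxE -[RHS](metric_mul_inverse (first_jet f x)).
by apply: eq_bigr => k _; rewrite !mxE sqnorm_gradient.
Qed.

Lemma metric_mulmx_weingarten f x :
  metric f x *m (gradient_function f x *: second_fundamental_form f x) = hessian f x.
Proof.
have v0 : gradient_function f x != 0.
  rewrite /gradient_function sqrtr_eq0 -ltNge sqnorm_gradient.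
  by have := norm2_ge0 (first_jet f x); lra.
have -> : gradient_function f x *: second_fundamental_form f x =
    inverse_metric f x *m hessian f x.
  apply/matrixP => i j; rewrite !mxE mulr_sumr; apply: eq_bigr => k _.
  by rewrite mulrCA [_ * (_ / _)]mulrC divfK.
by rewrite mulmxA metric_mulmx_inverse mul1mx.
Qed.

Lemma mulmx_quad (A : 'M[R]_n) (xi : 'cV[R]_n) :
  (xi^T *m (A *m xi)) 0 0 = quad A (fun i => xi i 0).
Proof.
rewrite mxE; apply: eq_bigr => i _; rewrite !mxE mulr_sumr.
by apply: eq_bigr => j _; ring.
Qed.

(** Lowering the index of the Weingarten map with the metric gives
    [D^2 f / v], so the curvature bound reads [D^2 f >= - c g]. *)
Lemma endo_ge_hessian (c : R) f x xi :
  endo_ge (metric f x) (gradient_function f x *: second_fundamental_form f x)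
    (- c)%:M ->
  - c * (norm2 xi + (\sum_i first_jet f x i * xi i) ^+ 2) <=
  quad (second_jet f x) xi.
Proof.
move=> /(_ (\col_i xi i)).
rewrite -!mulmxA (mulmxA (metric f x) (_ *: _)) metric_mulmx_weingarten.
rewrite mul_scalar_mx -!scalemxAr [X in X <= _]mxE !mulmx_quad.
have -> : (fun i => (\col_i xi i) i 0) = xi by apply/funext => i; rewrite mxE.
congr (_ * _ <= _).
have -> : metric f x = \matrix_(i, j) (1 * (i == j)%:R +
    1 * (first_jet f x i * first_jet f x j)).
  by apply/matrixP => i j; rewrite !mxE !mul1r.
transitivity (quad (fun i j => 1 * (i == j)%:R +
    1 * (first_jet f x i * first_jet f x j)) xi).
  by apply: eq_bigr => i _; apply: eq_bigr => j _; rewrite mxE.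
rewrite quad_linear quad_rank1 !mul1r; congr (_ + _).
apply: eq_bigr => i _; under eq_bigr => j _ do rewrite mulrC.
by rewrite sum_delta -expr2.
Qed.

End GraphGeometry.

(** * Local extensions in space-time and their derivatives *)

Section LocalExtension.
Variables (R : realType) (n : nat).
Notation spacetime := ('rV[R]_n * R)%type.
Implicit Types (T : R) (Omega : R -> set 'rV[R]_n) (u g : spacetime -> R).
Implicit Types (U : set spacetime) (x y : 'rV[R]_n) (p q : spacetime).

Definition space_dir (i : 'I_n) : spacetime := (delta_mx 0 i, 0).
Definition space_vector (xi : 'I_n -> R) : spacetime :=
  \sum_i xi i *: space_dir i.
Definition time_dir : spacetime := (0, 1).

Lemma time_line x t r : (x, t) + r *: time_dir = (x, t + r).
Proof. by congr pair; rewrite /= ?scaler0 ?addr0 // [_ *: _]mulr1. Qed.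

Lemma positive_domainP T Omega p :
  positive_domain T Omega p <-> 0 < p.2 <= T /\ Omega p.2 p.1.
Proof.
split=> [[[/andP[p0 pT] Op] np]|[/andP[p0 pT] Op]].
  split=> //; rewrite pT andbT lt_neqAle p0 andbT.
  apply/eqP => p20; apply: np; split => //=; first by rewrite p20.
by split; [split; rewrite // (ltW p0) | move=> [_ /= p20]; move: p0; rewrite p20 ltxx].
Qed.

(** [g] extends [u] past the final time, so that one-sided derivatives of [u]
    become ordinary directional derivatives of [g]. *)
Definition extends_near T Omega u p U g : Prop :=
  [/\ open U, U p, Ck 2 U g, forall q, U q -> 0 < q.2 &
      forall q, U q -> q.2 <= T -> domain T Omega q /\ u q = g q].

Lemma extends_nearP T Omega u p :
  relatively_open (slab n T) (domain T Omega) ->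
  smooth_on (positive_domain T Omega) u -> positive_domain T Omega p ->
  exists U g, extends_near T Omega u p U g.
Proof.
move=> [W Wo OE] smooth_u pD; have [U [g [Uo Up Ug gu]]] := smooth_u p pD.
have [/andP[p0 pT] Omp] := (positive_domainP T Omega p).1 pD.
have CW k W0 : W0 `<=` U -> Ck k U g -> Ck k W0 g.
  move=> WU; elim: k g {Ug gu} => [|k IH] f [fc fD]; split=> //.
  - by move=> z /WU /fc.
  - by move=> z /WU /fc.
  - by move=> v; have [dv Cv] := fD v; split; [move=> z /WU /dv | exact: IH].
exists (U `&` W `&` [set q | 0 < q.2]), g; split.
- apply: openI; first exact: openI.
  by apply: (@open_comp _ _ snd [set s : R | 0 < s]); [move=> q _; exact: cvg_snd|exact: open_gt].
- by do 2!split=> //; case: pD; rewrite OE => -[].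
- by apply: CW (Ug 2%N) => q [[]].
- by move=> q [].
- move=> q [[Uq Oq] /= q0] qT.
  have Dq : domain T Omega q by rewrite OE; split=> //; rewrite /slab /= (ltW q0).
  split=> //; rewrite gu //; rewrite inE; split=> //.
  by apply/positive_domainP; rewrite q0 qT; case: Dq.
Qed.

Lemma nbhs_slice U y t : open U -> U (y, t) -> \forall z \near y, U (z, t).
Proof.
move=> Uo Uy.
have : nbhs (y, t) U by exact: open_nbhs_nbhs.
move=> [[A B] /= [nA nB] AB]; apply: filterS nA => z Az.
by apply: AB; split=> //=; exact: nbhs_singleton.
Qed.

Lemma derive_slice g y t v :
  'D_v (fun z => g (z, t)) y = 'D_(v, 0) g (y, t).
Proof.
have E : (fun h => h^-1 *: (((fun z => g (z, t)) \o shift y) (h *: v) - g (y, t))) =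
   (fun h => h^-1 *: ((g \o shift (y, t)) (h *: (v, 0)) - g (y, t))).
  apply/funext => h /=; congr (_ *: (g _ - _)).
  by congr pair; rewrite /= scaler0 add0r.
by rewrite /derive E.
Qed.

Section Extended.
Variables (T : R) (Omega : R -> set 'rV[R]_n) (u : spacetime -> R).
Variables (x : 'rV[R]_n) (t : R) (U : set spacetime) (g : spacetime -> R).
Hypothesis tT : t <= T.
Hypothesis Eg : extends_near T Omega u (x, t) U g.

Lemma partial_extension i y : U (y, t) ->
  partial i (slice u t) y = 'D_(space_dir i) g (y, t).
Proof.
case: Eg => Uo _ _ _ ug Uy; rewrite -derive_slice; apply: near_eq_derive.
near=> z; have Uz : U (z, t) by near: z; exact: nbhs_slice.
by have [] := ug _ Uz tT.
Unshelve. all: by end_near. Qed.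

Lemma second_jet_extension i j :
  second_jet (slice u t) x i j = 'D_(space_dir i) ('D_(space_dir j) g) (x, t).
Proof.
case: (Eg) => Uo Ux _ _ ug; rewrite /second_jet mxE -derive_slice.
apply: near_eq_derive; near=> z; apply: partial_extension.
by near: z; exact: nbhs_slice.
Unshelve. all: by end_near. Qed.

Lemma first_jet_directional xi :
  \sum_i first_jet (slice u t) x i * xi i = 'D_(space_vector xi) g (x, t).
Proof.
case: (Eg) => Uo Ux Cg _ ug.
have C1 : Ck 1 U g.
  have [gc gC] := Cg; split=> // v; have [dv [cv _]] := gC v.
  by split.
rewrite (derivative_sum_direction _ _ _ Uo Ux C1); apply: eq_bigr => i _.
by rewrite mulrC -partial_extension.
Qed.

Lemma second_jet_directional xi :
  quad (second_jet (slice u t) x) xi =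
  'D_(space_vector xi) ('D_(space_vector xi) g) (x, t).
Proof.
case: (Eg) => Uo Ux Cg _ ug.
rewrite (second_derivative_sum_direction _ _ Uo Ux Cg).
by apply: eq_bigr => i _; apply: eq_bigr => j _; rewrite -second_jet_extension.
Qed.

Lemma time_derivative_extension l : time_derivative_is T u (x, t) l ->
  'D_time_dir g (x, t) = l.
Proof.
case: (Eg) => Uo Ux [_ gC] Upos ug ul.
have [dg _] := gC time_dir.
have := @is_derive_line R _ g (x, t) time_dir 0.
rewrite scale0r addr0 => /(_ (dg _ Ux)) /is_derive1_caratheodory[q [gE qc <-]].
have t0 : 0 < t := Upos _ Ux.
have qc' : q (s - t) @[s --> t^'-] --> q 0.
  apply: (@cvg_comp _ _ _ (fun s => s - t) q _ (nbhs (0 : R))); last exact: qc.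
  by apply: cvg_at_left_filter; rewrite -[X in _ --> X](subrr t); apply: cvgB; [exact: cvg_id|exact: cvg_cst].
have ul' : (u (x, s) - u (x, t)) / (s - t) @[s --> t^'-] --> l.
  apply: cvg_trans ul; apply: cvg_app => A nA.
  have {}nA : \forall s \near t, s != t -> `]0, T]%classic s -> A s := nA.
  have s0 : \forall s \near t, 0 < s by exact: lt_nbhsr.
  have nA' : \forall s \near t, s < t -> A s.
    apply: filterS2 nA s0 => s As {}s0 st.
    apply: As; first by rewrite lt_eqF.
    by rewrite /= in_itv /= s0 (ltW (lt_le_trans st tT)).
  exact: nA'.
have nU : \forall s \near t, U (x, s).
  have : nbhs (x, t) U by exact: open_nbhs_nbhs.
  move=> [[A B] /= [nA nB] AB]; apply: filterS nB => s Bs.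
  by apply: AB; split=> //=; exact: nbhs_singleton.
apply: (cvg_unique (@norm_hausdorff _ R) qc' _).
apply: cvg_trans ul'; apply: near_eq_cvg; near=> s.
have st : s < t by near: s; exact: nbhs_left_lt.
have Us : U (x, s) by near: s; exact: cvg_within nU.
have [_ ->] := ug _ Us (ltW (lt_le_trans st tT)).
have [_ ->] := ug _ Ux tT.
have := gE (s - t); rewrite scale0r addr0 subr0 time_line [t + _]addrC subrK => ->.
by rewrite mulfK // subr_eq0 lt_eqF.
Unshelve. all: by end_near. Qed.

End Extended.
End LocalExtension.

(** * The gap of two exponentials at a maximum *)

Section ExponentialDifference.
Variables (R : realType) (V : normedModType R).
Implicit Types (U : set V) (g : V -> R) (p v : V).

Lemma near_line U p v : open U -> U p -> \forall s \near (0 : R), U (p + s *: v).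
Proof.
move=> Uo Up.
have c : (p + s *: v) @[s --> (0 : R)] --> p.
  rewrite -[X in _ --> X]addr0; apply: cvgD; first exact: cvg_cst.
  by rewrite -[X in _ --> X](scale0r v); apply: cvgZr_tmp; exact: cvg_id.
by apply: c; exact: open_nbhs_nbhs.
Qed.

Lemma is_derive_exp_line g p v s : derivable g (p + s *: v) v ->
  is_derive (s : R) 1 (fun r => expR (- g (p + r *: v)))
    (- ('D_v g (p + s *: v) * expR (- g (p + s *: v)))).
Proof.
move=> dg; have dl := is_derive_line dg.
have dNl := is_deriveN dl.
have -> : - ('D_v g (p + s *: v) * expR (- g (p + s *: v))) =
  expR (- g (p + s *: v)) * - 'D_v g (p + s *: v) by ring.
exact: (@is_derive1_comp _ expR (fun r => - g (p + r *: v))).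
Qed.

(** The first and second derivative tests along a line, using
    [(exp (- g))'' = - exp (- g) (g'' - g'^2)]. *)
Lemma exp_difference_at_spatial_max U1 U2 g1 g2 p v :
  open U1 -> U1 p -> Ck 2 U1 g1 -> open U2 -> U2 p -> Ck 2 U2 g2 ->
  (\forall s \near (0 : R), expR (- g2 (p + s *: v)) - expR (- g1 (p + s *: v)) <=
     expR (- g2 p) - expR (- g1 p)) ->
  expR (- g1 p) * 'D_v g1 p = expR (- g2 p) * 'D_v g2 p /\
  expR (- g1 p) * ('D_v ('D_v g1) p - ('D_v g1 p) ^+ 2) <=
  expR (- g2 p) * ('D_v ('D_v g2) p - ('D_v g2 p) ^+ 2).
Proof.
move=> U1o U1p C1 U2o U2p C2 pmax.
pose E g r : R := expR (- g (p + r *: v)).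
pose dE g r : R := - ('D_v g (p + r *: v) * E g r).
have p0 : p + (0 : R) *: v = p by rewrite scale0r addr0.
have near_dE U g : open U -> U p -> Ck 2 U g ->
    \forall s \near (0 : R), is_derive (s : R) 1 (E g) (dE g s).
  move=> Uo Up [_ /(_ v)[dg _]].
  apply: filterS (near_line v Uo Up) => s Us.
  exact: is_derive_exp_line (dg _ Us).
have ddE U g : open U -> U p -> Ck 2 U g ->
    is_derive (0 : R) 1 (dE g)
      (- (expR (- g p) * ('D_v ('D_v g) p - ('D_v g p) ^+ 2))).
  move=> Uo Up [_ /(_ v)[dg [_ /(_ v)[ddg _]]]].
  have d1 : is_derive (0 : R) 1 (E g) (dE g 0).
    by apply: is_derive_exp_line; rewrite p0; exact: dg.
  have d2 : is_derive (0 : R) 1 (fun r => 'D_v g (p + r *: v))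
      ('D_v ('D_v g) (p + (0 : R) *: v)).
    by apply: is_derive_line; rewrite p0; exact: ddg.
  have d3 := is_deriveN (is_deriveM d2 d1).
  apply: is_derive_eq d3 _.
  by rewrite /dE /E p0 /GRing.scale /=; ring.
pose k r : R := E g2 r - E g1 r.
pose dk r : R := dE g2 r - dE g1 r.
have [||| dk0 ddk0] := @second_derivative_at_max R k dk
  (- (expR (- g2 p) * ('D_v ('D_v g2) p - ('D_v g2 p) ^+ 2)) -
   - (expR (- g1 p) * ('D_v ('D_v g1) p - ('D_v g1 p) ^+ 2))).
- by apply: filterS2 (near_dE _ _ U1o U1p C1) (near_dE _ _ U2o U2p C2) => s d1 d2;
  exact: is_deriveB.
- by apply: is_deriveB; [exact: ddE U2o U2p C2|exact: ddE U1o U1p C1].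
- by apply: filterS pmax => s; rewrite /k /E p0.
- split; last by move: ddk0; rewrite opprK addrC subr_le0.
  move: dk0; rewrite /dk /dE /E p0 opprK addrC => /subr0_eq.
  by rewrite mulrC => ->; rewrite mulrC.
Qed.

Lemma exp_difference_at_left_max (C : R) U1 U2 g1 g2 p v :
  open U1 -> U1 p -> Ck 2 U1 g1 -> open U2 -> U2 p -> Ck 2 U2 g2 ->
  (\forall s \near 0^'-, expR (- (C * s)) *
      (expR (- g2 (p + s *: v)) - expR (- g1 (p + s *: v))) <=
     expR (- g2 p) - expR (- g1 p)) ->
  C * (expR (- g2 p) - expR (- g1 p)) <=
  expR (- g1 p) * 'D_v g1 p - expR (- g2 p) * 'D_v g2 p.
Proof.
move=> U1o U1p C1 U2o U2p C2 pmax.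
have p0 : p + (0 : R) *: v = p by rewrite scale0r addr0.
have dE U g : U p -> Ck 2 U g ->
    is_derive (0 : R) 1 (fun r => expR (- g (p + r *: v)))
      (- ('D_v g p * expR (- g p))).
  move=> Up [_ /(_ v)[dg _]]; have := @is_derive_exp_line g p v 0.
  by rewrite p0; apply; exact: dg.
have dC : is_derive (0 : R) 1 (fun r : R => expR (- (C * r))) (- C).
  have -> : - C = expR (- (C * 0)) * - C by rewrite mulr0 oppr0 expR0 mul1r.
  apply: (@is_derive1_comp _ expR (fun r => - (C * r))).
  by apply: is_derive_eq; rewrite /GRing.scale /= mulr1.
have := is_deriveM dC (is_deriveB (dE _ _ U2p C2) (dE _ _ U1p C1)).
set k := (X in is_derive _ _ X _); set l := (X in is_derive _ _ _ X) => dk.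
have -> : expR (- g1 p) * 'D_v g1 p - expR (- g2 p) * 'D_v g2 p =
    l + C * (expR (- g2 p) - expR (- g1 p)).
  have -> : l = 1 * (- ('D_v g2 p * expR (- g2 p)) - - ('D_v g1 p * expR (- g1 p)))
     + (expR (- g2 (p + (0 : R) *: v)) - expR (- g1 (p + (0 : R) *: v))) * - C.
    by rewrite /l mulr0 oppr0 expR0.
  by rewrite p0; ring.
rewrite lerDr; apply: derivative_at_left_max dk _.
apply: filterS pmax => s Hs.
have -> : k 0 = expR (- (C * 0)) *
    (expR (- g2 (p + (0 : R) *: v)) - expR (- g1 (p + (0 : R) *: v))) by [].
by rewrite p0 mulr0 oppr0 expR0 mul1r.
Qed.

End ExponentialDifference.

(** * No positive interior maximum of the weighted gap *)

Section InteriorMaximum.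
Variables (R : realType) (n : nat) (T : R) (Omega : R -> set 'rV[R]_n).
Notation spacetime := ('rV[R]_n * R)%type.
Implicit Types (u : spacetime -> R) (x : 'rV[R]_n) (p q : spacetime) (c : R).

Lemma space_line x t (xi : 'I_n -> R) s : ((x, t) + s *: space_vector xi).2 = t.
Proof.
have /= -> : (space_vector xi).2 = 0; last by rewrite scaler0 addr0.
apply: (big_ind (fun q : spacetime => q.2 = 0)) => //= [p q /= -> ->|i _].
  by rewrite addr0.
by rewrite scaler0.
Qed.

Lemma mcf_extension u x t U g : t <= T -> extends_near T Omega u (x, t) U g ->
  graphical_mcf T Omega u -> positive_domain T Omega (x, t) ->
  'D_(time_dir R n) g (x, t) =
  graph_trace (first_jet (slice u t) x) (second_jet (slice u t) x).
Proof.
move=> tT Eg flow pD; rewrite -graph_traceE_inverse_metric.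
exact: (time_derivative_extension tT Eg (flow _ pD)).
Qed.

Definition weighted_gap (C : R) u1 u2 q : R :=
  expR (- (C * q.2)) * (expR (- u2 q) - expR (- u1 q)).

Hypothesis D_open : relatively_open (slab n T) (domain T Omega).

(** The exponential rate [2 c + 2] beats the constant of
    [graph_trace_comparison] by one, which makes the inequality at the maximum
    strict. *)
Lemma weighted_gap_no_positive_max c u1 u2 p : 0 < c ->
  smooth_on (positive_domain T Omega) u1 -> graphical_mcf T Omega u1 ->
  smooth_on (positive_domain T Omega) u2 -> graphical_mcf T Omega u2 ->
  curvature_bound T Omega c u2 ->
  positive_domain T Omega p -> 0 < weighted_gap (2 * c + 2) u1 u2 p ->
  (forall q, domain T Omega q ->
    weighted_gap (2 * c + 2) u1 u2 q <= weighted_gap (2 * c + 2) u1 u2 p) ->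
  False.
Proof.
move=> c0 s1 flow1 s2 flow2 curv2; case: p => x t pD Wp Wmax.
have [/andP[/= t0 tT] Ox] := (positive_domainP T Omega (x, t)).1 pD.
have [U1 [g1 e1]] := extends_nearP D_open s1 pD.
have [U2 [g2 e2]] := extends_nearP D_open s2 pD.
have [U1o U1p C1 _ ug1] := e1; have [U2o U2p C2 _ ug2] := e2.
have [_ u1p] := ug1 _ U1p tT; have [_ u2p] := ug2 _ U2p tT.
have gap0 : 0 < expR (- g2 (x, t)) - expR (- g1 (x, t)).
  by move: Wp; rewrite /weighted_gap u1p u2p pmulr_rgt0 // expR_gt0.
have gap_le q : U1 q -> U2 q -> q.2 <= T ->
    expR (- ((2 * c + 2) * q.2)) * (expR (- g2 q) - expR (- g1 q)) <=
    expR (- ((2 * c + 2) * t)) * (expR (- g2 (x, t)) - expR (- g1 (x, t))).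
  move=> Uq1 Uq2 qT; have [Dq u1q] := ug1 _ Uq1 qT; have [_ u2q] := ug2 _ Uq2 qT.
  by have := Wmax q Dq; rewrite /weighted_gap u1q u2q u1p u2p.
have spatial xi : expR (- g1 (x, t)) * 'D_(space_vector xi) g1 (x, t) =
      expR (- g2 (x, t)) * 'D_(space_vector xi) g2 (x, t) /\
    expR (- g1 (x, t)) * ('D_(space_vector xi) ('D_(space_vector xi) g1) (x, t)
      - ('D_(space_vector xi) g1 (x, t)) ^+ 2) <=
    expR (- g2 (x, t)) * ('D_(space_vector xi) ('D_(space_vector xi) g2) (x, t)
      - ('D_(space_vector xi) g2 (x, t)) ^+ 2).
  apply: (exp_difference_at_spatial_max U1o U1p C1 U2o U2p C2).
  apply: filterS2 (near_line (space_vector xi) U1o U1p)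
    (near_line (space_vector xi) U2o U2p) => s Us1 Us2.
  have := gap_le _ Us1 Us2; rewrite space_line => /(_ tT).
  by rewrite ler_pM2l ?expR_gt0.
have temporal : (2 * c + 2) * (expR (- g2 (x, t)) - expR (- g1 (x, t))) <=
    expR (- g1 (x, t)) * 'D_(time_dir R n) g1 (x, t) -
    expR (- g2 (x, t)) * 'D_(time_dir R n) g2 (x, t).
  apply: (exp_difference_at_left_max U1o U1p C1 U2o U2p C2).
  have nU1 : \forall s \near (0 : R)^'-, U1 ((x, t) + s *: time_dir R n).
    by apply: cvg_within; exact: near_line.
  have nU2 : \forall s \near (0 : R)^'-, U2 ((x, t) + s *: time_dir R n).
    by apply: cvg_within; exact: near_line.
  near=> s.
  have s0 : s < 0 by near: s; exact: nbhs_left_lt.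
  have Us1 : U1 ((x, t) + s *: time_dir R n) by near: s.
  have Us2 : U2 ((x, t) + s *: time_dir R n) by near: s.
  move: (gap_le _ Us1 Us2); rewrite time_line /= => H.
  have := H (ltac:(by rewrite (le_trans _ tT) // gerDl ltW)).
  rewrite (mulrDr (2 * c + 2)) opprD expRD -mulrA ler_pM2l ?expR_gt0 //.
rewrite (mcf_extension tT e1 flow1 pD) (mcf_extension tT e2 flow2 pD) in temporal.
have := @graph_trace_comparison R n c (expR (- g1 (x, t))) (expR (- g2 (x, t)))
  (first_jet (slice u1 t) x) (first_jet (slice u2 t) x)
  (second_jet (slice u1 t) x) (second_jet (slice u2 t) x) c0.
rewrite expR_gt0 -subr_gt0 gap0 => /(_ isT) comparison.
have {comparison} : (2 * c + 2) * (expR (- g2 (x, t)) - expR (- g1 (x, t))) <=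
    (2 * c + 1) * (expR (- g2 (x, t)) - expR (- g1 (x, t))).
  apply: le_trans temporal (comparison _ _ _).
  - move=> i; have [+ _] := spatial (fun j => (i == j)%:R).
    rewrite -(first_jet_directional tT e1) -(first_jet_directional tT e2).
    by do 2!(under eq_bigr do rewrite mulrC; rewrite sum_delta).
  - move=> xi; have [_] := spatial xi.
    rewrite -(first_jet_directional tT e1) -(first_jet_directional tT e2).
    by rewrite -(second_jet_directional tT e1) -(second_jet_directional tT e2).
  - by move=> xi; apply: endo_ge_hessian; apply: curv2 => //; rewrite t0 tT.
by rewrite ler_pM2r // lerD2l (ler_nat R 2 1).
Unshelve. all: by end_near. Qed.

End InteriorMaximum.

(** * The lower barrier *)

Section LowerBarrier.
Variables (R : realType) (n : nat) (T : R) (Omega : R -> set 'rV[R]_n).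
Notation spacetime := ('rV[R]_n * R)%type.
Implicit Types (u : spacetime -> R) (x : 'rV[R]_n).
Implicit Types (p q : spacetime) (s t c K : R).

Hypothesis D_open : relatively_open (slab n T) (domain T Omega).

(** The sequential blow-up hypothesis in neighbourhood form, which can be used
    along any approach to the boundary. *)
Lemma blowup_near u p K : blows_up_at_boundary T Omega u ->
  relative_boundary (slab n T) (domain T Omega) p ->
  \forall q \near p, domain T Omega q -> K < u q.
Proof.
case: p => x t blow bd; apply: contrapT => far.
have seqP (k : nat) : exists q, ball (x, t) (k.+1%:R^-1 : R) q /\
    domain T Omega q /\ u q <= K.
  apply: contrapT => nex; apply: far; apply/nbhs_ballP.
  exists (k.+1%:R^-1) => /=; first by rewrite invr_gt0.
  move=> q qb Dq; rewrite ltNge; apply/negP => uq; apply: nex.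
  by exists q.
have [q qP] := choice seqP.
have cq : q k @[k --> \oo] --> (x, t).
  apply/cvg_ballP => e e0.
  have [N _ Ne] := near_infty_natSinv_lt (PosNum e0).
  exists N => // k /= Nk; apply: le_ball (qP k).1.
  by apply: ltW; exact: (Ne k Nk).
have enx : 0 < enorm x + 1 by rewrite ltr_wpDl // sqrtr_ge0.
have := blow q x t (enorm x + 1) (fun k => (qP k).2.1) bd enx
  (ltac:(by rewrite lerDl)) cq.
move=> /cvgryPgt /(_ K) [N _ /(_ N (leqnn N))] /=.
by rewrite ltNge (qP N).2.2.
Qed.

Lemma domain_near_time x t : domain T Omega (x, t) ->
  \forall s \near t, 0 <= s <= T -> Omega s x.
Proof.
move: D_open => [W Wo DE]; rewrite DE => -[_ Wxt].
have : nbhs (x, t) W by exact: open_nbhs_nbhs.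
move=> [[A B] /= [nA nB] AB]; apply: filterS nB => s Bs sT.
have : domain T Omega (x, s); last by case.
by rewrite DE; split=> //; apply: AB; split=> //=; exact: nbhs_singleton.
Qed.

Section Barrier.
Variables (c : R) (u : spacetime -> R).
Hypothesis (c_gt0 : 0 < c).
Hypothesis (u_smooth : smooth_on (positive_domain T Omega) u).
Hypothesis (u_flow : graphical_mcf T Omega u).
Hypothesis (u_curv : curvature_bound T Omega c u).

Let rate : R := c * n%:R.

Lemma rate_ge0 : 0 <= rate. Proof. by rewrite mulr_ge0 // ltW. Qed.

(** [dt u >= - c n], because [D^2 u >= - c g] and the trace of [g] is [n]. *)
Lemma drift_monotone x (a b : R) : 0 < a -> a <= b -> b <= T ->
  (forall s, a <= s <= b -> Omega s x) ->
  u (x, a) + rate * a <= u (x, b) + rate * b.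
Proof.
move=> a0 ab bT Oab.
pose f s := u (x, s) + rate * s.
have ext s : a <= s <= b -> exists g, [/\ is_derive s 1 (fun r => g (x, r) + rate * r)
    ('D_(time_dir R n) g (x, s) + rate),
    \forall r \near s, r <= T -> f r = g (x, r) + rate * r &
    0 <= 'D_(time_dir R n) g (x, s) + rate].
  move=> /andP[as_ sb]; have s0 : 0 < s := lt_le_trans a0 as_.
  have sT : s <= T := le_trans sb bT.
  have Os : Omega s x by apply: Oab; rewrite as_ sb.
  have pD : positive_domain T Omega (x, s).
    by apply/positive_domainP; rewrite /= s0 sT.
  have [U [g Eg]] := extends_nearP D_open u_smooth pD.
  have [Uo Us [_ /(_ (time_dir R n))[dg _]] _ ug] := Eg.
  exists g; split.
  - have := @is_derive_line R _ g (x, 0) (time_dir R n) s.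
    rewrite time_line add0r => /(_ (dg _ Us)).
    have -> : (fun r => g ((x, 0) + r *: time_dir R n)) = (fun r => g (x, r)).
      by apply/funext => r; rewrite time_line add0r.
    move=> dgs; have dr : is_derive s 1 (fun r : R => rate * r) rate.
      by apply: is_derive_eq; rewrite /GRing.scale /= mulr1.
    exact: is_deriveD.
  - have : nbhs (x, s) U by exact: open_nbhs_nbhs.
    move=> [[A B] /= [nA nB] AB]; apply: filterS nB => r Br rT.
    rewrite /f; have [] := ug (x, r) _ rT => [|_ -> //].
    by apply: AB; split=> //=; exact: nbhs_singleton.
  - rewrite (mcf_extension sT Eg u_flow pD).
    rewrite -lerBlDr sub0r /rate -mulNr; apply: graph_trace_lower_bound => xi.
    by apply: endo_ge_hessian; apply: u_curv => //; rewrite s0 sT.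
have f_at s : a < s < b -> exists g, is_derive s 1 f ('D_(time_dir R n) g (x, s) + rate)
    /\ 0 <= 'D_(time_dir R n) g (x, s) + rate.
  move=> /andP[as_ sb]; have [|g [dg fg g0]] := ext s; first by rewrite !ltW.
  exists g; split=> //; apply: near_eq_is_derive dg.
  have rT : \forall r \near s, r < T by exact: lt_nbhsl (lt_le_trans sb bT).
  by apply: filterS2 fg rT => r fr rT'; rewrite fr // ltW.
apply: (@ger0_derive1_le_cc _ f a b) => //; rewrite ?in_itv /= ?lexx ?ab //.
- by move=> s; rewrite in_itv /= => /f_at[g [[]]].
- by move=> s; rewrite in_itv /= => /f_at[g [ds g0]]; rewrite derive1E derive_val.
apply/subspace_continuousP => s; rewrite /= in_itv /= => sab.
have [g [dg fg _]] := ext s sab.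
have sT : s <= T by case/andP: sab => _ sb; exact: le_trans bT.
rewrite /from_subspace (nbhs_singleton fg sT).
have gc : {for s, continuous (fun r => g (x, r) + rate * r)}.
  by apply: differentiable_continuous; apply/derivable1_diffP; case: dg.
have gw : (g (x, r) + rate * r) @[r --> within `[a, b] (nbhs s)] -->
    g (x, s) + rate * s by exact: cvg_within_filter gc.
apply: cvg_trans gw; apply: near_eq_cvg.
apply: filterS fg => r fr; rewrite /= in_itv /= => /andP[_ rb].
by rewrite -fr // (le_trans rb).
Qed.

(** Following a point backwards in time, [u] increases at most at the rate
    [c n], so that it stays bounded and the point cannot meet the boundary of the
    domain, where [u] blows up. *)
Lemma lower_barrier (u0 : 'rV[R]_n -> R) x t : blows_up_at_boundary T Omega u ->
  initial_data Omega u0 u -> domain T Omega (x, t) -> 0 < t ->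
  Omega 0 x /\ u0 x <= u (x, t) + rate * t.
Proof.
move=> blow [_ init] Dxt t0; have [/= /andP[_ tT] Oxt] := Dxt.
(* [A] collects the times back to which [x] can be followed in the domain. *)
pose A := [set s | 0 <= s <= t /\ forall r, s <= r <= t -> Omega r x].
have At : A t.
  split; first by rewrite ltW // lexx.
  by move=> r; rewrite -eq_le => /eqP <-.
have hiA : has_inf A by split; [exists t | exists 0 => s [/andP[]]].
pose s0 := inf A.
have s0ge0 : 0 <= s0 by apply: lb_le_inf; [exists t | move=> s [/andP[]]].
have s0t : s0 <= t by apply: ge_inf => //; case: hiA.
have Oafter r : s0 < r <= t -> Omega r x.
  move=> /andP[s0r rt]; have [s [_ sA] sr] := inf_lt hiA.1 s0r.
  by apply: sA; rewrite rt ltW.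
have bound r : 0 < r -> s0 < r <= t -> u (x, r) + rate * r <= u (x, t) + rate * t.
  move=> r0 /andP[s0r rt]; apply: drift_monotone => // s /andP[rs st].
  by apply: Oafter; rewrite st andbT (lt_le_trans s0r).
have slab0 : slab n T (x, s0) by rewrite /slab /= s0ge0 (le_trans s0t).
have Os0 : Omega s0 x.
  apply: contrapT => nO.
  have nD : ~ domain T Omega (x, s0) by move=> [].
  have s0lt : s0 < t.
    by rewrite lt_neqAle s0t andbT; apply/eqP => s0E; apply: nO; rewrite s0E.
  have near_after (B : set spacetime) : nbhs (x, s0) B ->
      exists2 r, s0 < r <= t & B (x, r).
    move=> [[B1 B2] [nB1 nB2] B12].
    have B1x : B1 x := @nbhs_singleton 'rV[R]_n x B1 nB1.
    have nB : \forall r \near s0, B2 r by [].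
    have /filter_ex[r [rt Br]] : \forall r \near s0^'+, s0 < r <= t /\ B2 r.
      near=> r; split; last by near: r; exact: cvg_within nB.
      apply/andP; split; first by near: r; exact: nbhs_right_gt.
      by near: r; exact: nbhs_right_le.
    by exists r => //; apply: B12.
  have bd : relative_boundary (slab n T) (domain T Omega) (x, s0).
    split=> //; split; last exact: subset_closure.
    move=> B /near_after[r rt Br]; exists (x, r); split=> //; split.
      by case/andP: rt => s0r rt /=; rewrite (le_trans s0ge0 (ltW s0r)) (le_trans rt).
    exact: Oafter.
  have [r rt] := near_after _ (blowup_near (u (x, t) + rate * t) blow bd).
  have Or := Oafter _ rt; case/andP: (rt) => s0r rt'.
  have r0 : 0 < r := le_lt_trans s0ge0 s0r.
  have : domain T Omega (x, r) by split=> //=; rewrite (ltW r0) (le_trans rt').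
  move=> Dr /(_ Dr); rewrite ltNge => /negP; apply.
  by apply: le_trans (bound _ r0 rt); rewrite lerDl mulr_ge0 // ?rate_ge0 // ltW.
(* The domain is relatively open, so the backward motion stops only at time 0. *)
have s00 : s0 = 0.
  apply/eqP; rewrite eq_le s0ge0 andbT leNgt; apply/negP => s0gt.
  have /nbhs_ballP[d /= d0 dP] := domain_near_time (conj slab0 Os0 : domain T Omega (x, s0)).
  pose s1 := Num.max 0 (s0 - d / 2).
  have s1lt : s1 < s0 by rewrite gt_max s0gt; lra.
  suff As1 : A s1 by have := ge_inf hiA.2 As1; rewrite leNgt s1lt.
  have s1ge : 0 <= s1 by rewrite le_max lexx.
  split; first by rewrite s1ge (le_trans (ltW s1lt)).
  move=> r /andP[s1r rt]; have [s0r|] := ltP s0 r; first by apply: Oafter; rewrite s0r.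
  move=> rs0; apply: dP; last by rewrite (le_trans s1ge) // (le_trans rt).
  rewrite -ball_normE /= ger0_norm ?subr_ge0 //.
  have : s0 - d / 2 <= s1 by rewrite le_max lexx orbT.
  by lra.
rewrite s00 in Os0 bound Oafter *; split=> //.
have := init [set x] (@compact_set1 _ x) (ltac:(by move=> _ ->)).
rewrite uniform_set1 => u_at_x.
have ux : u (x, r) @[r --> 0^'+] --> u0 x by exact: u_at_x.
apply: (cvgr_to_le ux); near=> r.
have r0 : 0 < r by near: r; exact: nbhs_right_gt.
have rt : r <= t by near: r; exact: nbhs_right_le.
apply: le_trans (bound r r0 _); last by rewrite r0.
by rewrite lerDl mulr_ge0 // ?rate_ge0 // ltW.
Unshelve. all: by end_near. Qed.

End Barrier.

Lemma locally_lipschitz_continuous (u0 : 'rV[R]_n -> R) x : locally_lipschitz (Omega 0) u0 ->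
  open (Omega 0) -> Omega 0 x -> {for x, continuous u0}.
Proof.
move=> lip Oo Ox; have [U nU /pinfty_ex_gt0[M M0 HM]] := lip x Ox.
have nO : \forall y \near x, Omega 0 y by exact: open_nbhs_nbhs.
have Ux := nbhs_singleton nU.
apply/(@cvgrPdist_lt _ _ _ (nbhs x) (nbhs_filter x)) => e e0.
have r0 : 0 < M^-1 * e by rewrite mulr_gt0 // invr_gt0.
apply: filterS3 nO nU (nbhsx_ballx x _ r0) => y Oy Uy.
rewrite -ball_normE /= => yx.
have /= := HM (x, y) (conj (conj Ox Ux) (conj Oy Uy)).
by move=> /le_lt_trans; apply; rewrite -ltr_pdivlMl.
Qed.

End LowerBarrier.

(** * Comparison of two solutions *)

Section Comparison.
Variables (R : realType) (n : nat) (T : R) (Omega : R -> set 'rV[R]_n).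
Notation spacetime := ('rV[R]_n * R)%type.
Implicit Types (u : spacetime -> R) (x : 'rV[R]_n) (p q : spacetime) (c : R).

Hypothesis D_open : relatively_open (slab n T) (domain T Omega).
Hypothesis Omega0_open : open (Omega 0).

Lemma uniform_cvg_near (K : set 'rV[R]_n) (u0 : 'rV[R]_n -> R) u (e : R) :
  0 < e -> {uniform K, slice u t @[t --> 0^'+] --> u0} ->
  \forall t \near 0^'+, forall y, K y -> `|u0 y - u (y, t)| < e.
Proof.
move=> e0 /(_ [set h | forall y, K y -> `|u0 y - h y| < e]); apply.
apply/uniform_nbhs; exists [set ab | ball ab.1 e ab.2]; split.
  exact: (entourage_ball _ (PosNum e0)).
by move=> h hK y /hK; rewrite /= -ball_normE.
Qed.

(** At the initial time, uniform convergence on a small closed ball together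
    with the continuity of [u0] gives continuity jointly in space and time. *)
Lemma continuous_on_domain (u0 : 'rV[R]_n -> R) u :
  locally_lipschitz (Omega 0) u0 ->
  smooth_on (positive_domain T Omega) u -> initial_data Omega u0 u ->
  {within domain T Omega, continuous u}.
Proof.
move=> lip smooth_u [u_init u_cvg]; apply/subspace_continuousP => -[x t] Dxt.
have [/= /andP[t0 tT] Oxt] := Dxt.
rewrite /from_subspace; apply/cvgrPdist_lt => e e0.
move: t0; rewrite le_eqVlt => /orP[/eqP t0|t0]; last first.
  have pD : positive_domain T Omega (x, t).
    by apply/positive_domainP; rewrite /= t0 tT.
  have [U [g [Uo Ux [gc _] _ ug]]] := extends_nearP D_open smooth_u pD.
  have nU : \forall q \near (x, t), U q by exact: open_nbhs_nbhs.
  have ng : \forall q \near (x, t), `|g (x, t) - g q| < e.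
    by move/cvgrPdist_lt : (gc _ Ux); apply.
  have [_ ->] := ug _ Ux tT.
  apply: filterS2 nU ng => q Uq gq [/andP[_ qT] _].
  by have [_ ->] := ug _ Uq qT.
rewrite -t0 in Oxt *; rewrite u_init //.
have e2 : 0 < e / 2 by rewrite divr_gt0.
have nO : nbhs x (Omega 0) by exact: open_nbhs_nbhs.
have /nbhs_closedballP[d dO] := nO.
have dK : compact (closed_ball x d%:num).
  rewrite closed_ballE //; apply: bounded_closed_compact; last exact: closed_closed_ball_.
  exists (`|x| + d%:num); split=> // M Mx y; rewrite /closed_ball_ /= => xy.
  rewrite -(subKr x y) (le_trans (ler_normB _ _)) // ltW // (le_lt_trans _ Mx) //.
  by rewrite lerD2l.
have nd : \forall y \near x, closed_ball x d%:num y.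
  by apply/nbhs_closedballP; exists d.
have nu0 : \forall y \near x, `|u0 x - u0 y| < e / 2.
  have /(@cvgrPdist_lt _ _ _ (nbhs x) (nbhs_filter x)) :=
    locally_lipschitz_continuous lip Omega0_open Oxt.
  by apply.
have nt : \forall s \near (0 : R), 0 < s ->
    forall y, closed_ball x d%:num y -> `|u0 y - u (y, s)| < e / 2.
  exact: uniform_cvg_near e2 (u_cvg _ dK dO).
have nxt : \forall q \near (x, 0 : R), (closed_ball x d%:num q.1 /\
    `|u0 x - u0 q.1| < e / 2) /\ (0 < q.2 -> forall y, closed_ball x d%:num y ->
    `|u0 y - u (y, q.2)| < e / 2).
  exists ([set y | closed_ball x d%:num y /\ `|u0 x - u0 y| < e / 2],
    [set s | 0 < s -> forall y, closed_ball x d%:num y -> `|u0 y - u (y, s)| < e / 2]).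
    by split=> //; exact: filterI.
  by move=> q [].
apply: filterS nxt => -[y s] /= [[yK yu] su] [/andP[/= s0 sT] Oys].
move: s0; rewrite le_eqVlt => /orP[/eqP s0|s0].
  by rewrite -s0 u_init; [lra | rewrite s0].
have := su s0 y yK; have := ler_distD (u0 y) (u0 x) (u (y, s)); lra.
Qed.

Lemma norm_le_enorm x : `|x| <= enorm x.
Proof.
rewrite [leLHS]/Num.norm /= mx_normrE; apply/bigmax_leP; split.
  exact: sqrtr_ge0.
move=> [i j] _ /=; rewrite ord1 -sqrtr_sqr ler_wsqrtr // /sqnorm (bigD1 j) //=.
by rewrite lerDl sumr_ge0 // => k _; exact: sqr_ge0.
Qed.

(** The superlevel set [S] of the weighted gap at a positive value [m] is compact:
    on it [exp (- u2) >= m], so [u2] is bounded above, which keeps [S] away from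
    the boundary of the domain by the blow-up of [u2], and bounded in space by
    the lower barrier. *)
Lemma comparison (c : R) (u0 : 'rV[R]_n -> R) u1 u2 : 0 < T -> 0 < c ->
  locally_lipschitz (Omega 0) u0 -> proper_graph (Omega 0) u0 ->
  smooth_proper_solution T Omega u0 u1 ->
  smooth_proper_solution T Omega u0 u2 ->
  curvature_bound T Omega c u2 -> blows_up_at_boundary T Omega u2 ->
  forall p, domain T Omega p -> u1 p <= u2 p.
Proof.
move=> T0 c0 lip [_ proper0] [smooth1 flow1 _ init1] [smooth2 flow2 _ init2].
move=> curv blow p Dp; rewrite leNgt; apply/negP => u21.
pose W := weighted_gap (2 * c + 2) u1 u2.
pose m := W p.
have m0 : 0 < m by rewrite mulr_gt0 ?expR_gt0 // subr_gt0 ltr_expR ltrN2.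
pose S := [set q | domain T Omega q /\ m <= W q].
have Sp : S p by split.
have DS q : S q -> domain T Omega q by case.
pose K := - ln m.
have SK q : S q -> u2 q <= K.
  move=> [[/andP[q0 _] _] mq].
  rewrite lerNr -ler_expR lnK //; apply: le_trans mq _.
  rewrite /W /weighted_gap.
  have e1 : expR (- ((2 * c + 2) * q.2)) <= 1.
    by rewrite -expR0 ler_expR oppr_le0 mulr_ge0 // addr_ge0 // mulr_ge0 // ltW.
  have := expR_gt0 (- ((2 * c + 2) * q.2)); have := expR_gt0 (- u1 q).
  have := expR_gt0 (- u2 q); move: e1.
  move: (expR _) (expR _) (expR _) => a b d; nra.
have [r rP] := proper0 (K + c * n%:R * T).
have Sr q : S q -> `|q.1| <= r.
  case: q => x t Sq; apply: le_trans (norm_le_enorm _) _ => /=.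
  have [/= /andP[t0 tT] Oxt] := DS _ Sq.
  suff [x0 ux] : Omega 0 x /\ u0 x <= K + c * n%:R * T.
    by rewrite leNgt; apply/negP => /(rP _ x0); rewrite ltNge ux.
  move: t0; rewrite le_eqVlt => /orP[/eqP t0|t0].
    rewrite -t0 in Oxt Sq; split=> //; have := SK _ Sq.
    by case: init2 => -> // _ => uK; rewrite ler_wpDr // !mulr_ge0 // ltW.
  have [x0 ux] := lower_barrier D_open c0 smooth2 flow2 curv blow init2 (DS _ Sq) t0.
  split=> //; apply: le_trans ux _; apply: lerD; first exact: SK.
  by rewrite ler_wpM2l // mulr_ge0 // ltW.
have Sslab : S `<=` slab n T by move=> q [[]].
have W_cont : {within domain T Omega, continuous W}.
  have c1 := (subspace_continuousP _ _).1 (continuous_on_domain lip smooth1 init1).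
  have c2 := (subspace_continuousP _ _).1 (continuous_on_domain lip smooth2 init2).
  apply/subspace_continuousP => q Dq; rewrite /from_subspace.
  have cE u : u @ within (domain T Omega) (nbhs q) --> u q ->
      (fun z => expR (- u z)) @ within (domain T Omega) (nbhs q) --> expR (- u q).
    move=> cu; apply: (cvg_comp (fun z => - u z) expR); first exact: cvgN cu.
    exact: continuous_expR.
  have weight_cvg : expR (- ((2 * c + 2) * z.2)) @[z --> within (domain T Omega) (nbhs q)]
      --> expR (- ((2 * c + 2) * q.2)).
    apply: (cE (fun z => (2 * c + 2) * z.2)).
    apply: cvgM; first exact: cvg_cst.
    by apply: cvg_within_filter; exact: cvg_snd.
  have gap_cvg := cvgB (cE u2 (c2 _ Dq)) (cE u1 (c1 _ Dq)).
  exact: cvgM weight_cvg (gap_cvg _).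
have S_closed : closed S.
  move=> q clq.
  have Dq : domain T Omega q.
    apply: contrapT => nDq.
    have slabq : slab n T q.
      have slab_closed : closed (slab n T : set spacetime).
        apply: (@closed_comp _ _ (snd : spacetime -> R) `[0, T]%classic); last exact: interval_closed.
        by move=> z _; exact: cvg_snd.
      by apply: slab_closed; apply: closure_subset clq.
    have bd : relative_boundary (slab n T) (domain T Omega) q.
      split=> //; split; last exact: subset_closure.
      by move=> B /clq[z [[Dz _] Bz]]; exists z.
    have [z [Sz]] := clq _ (blowup_near K blow bd).
    by move=> /(_ (DS _ Sz)); rewrite ltNge SK.
  split=> //; rewrite leNgt; apply/negP => Wq.
  have Wq_cvg : W z @[z --> within (domain T Omega) (nbhs q)] --> W q.
    by move/subspace_continuousP : W_cont; exact.
  have near_q : \forall z \near q, domain T Omega z -> W z < m.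
    exact: (cvgr_lt _ Wq_cvg _ Wq).
  have [z [[Dz mz]]] := clq _ near_q.
  by move=> /(_ Dz); rewrite ltNge => /negP; apply.
have S_compact : compact S.
  have box : compact ([set x : 'rV[R]_n | `|x| <= r] `*` `[0, T]%classic).
    apply: compact_setX; last exact: segment_compact.
    apply: bounded_closed_compact.
      by exists r; split; [exact: num_real | move=> M rM y /= /le_trans -> //; exact: ltW].
    apply: (@closed_comp _ _ (fun y : 'rV[R]_n => `|y|) [set s | s <= r]); last exact: closed_le.
    by move=> y _; exact: norm_continuous.
  apply: subclosed_compact S_closed box _ => q Sq; split; first exact: Sr.
  by rewrite /= in_itv; exact: Sslab.
have [q /set_mem Sq qmax] := compact_EVT_max (ex_intro _ p Sp) S_compact
  (continuous_subspaceW DS W_cont).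
have Wmax z : domain T Omega z -> W z <= W q.
  move=> Dz; have [mz|/ltW zm] := leP m (W z); first by apply: qmax; apply/mem_set.
  by apply: le_trans zm _; case: Sq.
have [/andP[q0 qT] Oq] := DS _ Sq.
have Wq0 : 0 < W q by case: Sq => _; exact: lt_le_trans.
have qpos : 0 < q.2.
  rewrite lt_neqAle q0 andbT; apply/eqP => q20; move: Wq0.
  rewrite /W /weighted_gap; move: Oq; rewrite -q20.
  have -> : q = (q.1, 0) by rewrite [in RHS]q20; case: (q).
  move=> /= Oq; case: init1 => -> // _; case: init2 => -> // _.
  by rewrite subrr mulr0 ltxx.
apply: (weighted_gap_no_positive_max D_open c0 smooth1 flow1 smooth2 flow2 curv
  _ Wq0 Wmax).
by apply/positive_domainP; rewrite qpos qT.
Qed.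

End Comparison.

Unset Implicit Arguments.
Set Strict Implicit.

Theorem theorem1p4 (R : realType) (n : nat) (T : R)
    (Omega : R -> set 'rV[R]_n) (M : R -> set 'rV[R]_n)
    (u0 : 'rV[R]_n -> R) (u1 u2 : 'rV[R]_n * R -> R) (c : R)
    (T_gt0 : 0 < T)
    (Omega0_open : open (Omega 0))
    (M_evolution : unique_smooth_evolution T (boundary (Omega 0)) M)
    (Omega_evolution : forall t, 0 < t <= T ->
       open (Omega t) /\ boundary (Omega t) = M t)
    (D_open : relatively_open (slab n T) (domain T Omega))
    (u0_lipschitz : locally_lipschitz (Omega 0) u0)
    (u0_proper : proper_graph (Omega 0) u0)
    (u1_solution : smooth_proper_solution T Omega u0 u1)
    (u2_solution : smooth_proper_solution T Omega u0 u2)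
    (c_gt0 : 0 < c)
    (u1_curvature : curvature_bound T Omega c u1)
    (u2_curvature : curvature_bound T Omega c u2)
    (u1_blowup : blows_up_at_boundary T Omega u1)
    (u2_blowup : blows_up_at_boundary T Omega u2) :
  (forall p, domain T Omega p -> u1 p = u2 p) /\
  (forall t, 0 < t <= T ->
     graph (Omega t) (slice u1 t) = graph (Omega t) (slice u2 t)).
Proof.
have le12 := comparison D_open Omega0_open T_gt0 c_gt0 u0_lipschitz u0_proper
  u1_solution u2_solution u2_curvature u2_blowup.
have le21 := comparison D_open Omega0_open T_gt0 c_gt0 u0_lipschitz u0_proper
  u2_solution u1_solution u1_curvature u1_blowup.
have eq12 p : domain T Omega p -> u1 p = u2 p.
  by move=> Dp; apply/eqP; rewrite eq_le le12 // le21.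
split=> // t /andP[t0 tT]; apply/seteqP; split=> _ [x Ox <-]; exists x => //;
  by rewrite /slice eq12 //; split; rewrite //= (ltW t0).
Qed.
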